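(* Let $\Sigma\in\mathbb{R}^{m\times m}$ be symmetric positive definite, $\pi_\mu(u)=\mathcal{N}(u;\mu,\Sigma)$ for $\mu\in\mathbb{R}^m$, and let $F$, $\rho_\mu$ be as in the context. Then, for every $\mu\in\mathbb{R}^m$, $$\nabla^2F(\mu)=\tau\Sigma^{-1}-\tau\Sigma^{-1}\operatorname{Cov}_{\rho_\mu}(u)\Sigma^{-1},$$ and hence, with $P=\frac1\tau\Sigma$, $$P^{1/2}\nabla^2F(\mu)P^{1/2}=I-\Sigma^{-1/2}\operatorname{Cov}_{\rho_\mu}(u)\Sigma^{-1/2}.$$
   Context: $C\subset\mathbb{R}^m$ is nonempty and compact with positive Lebesgue measure, $f_0:\mathbb{R}^m\to\mathbb{R}$ is continuous, $\tau>0$. $\mathcal{N}(u;\mu,\Sigma)$ is the Gaussian density with mean $\mu$ and covariance $\Sigma$. Define $$Z(\mu):=\int_C\pi_\mu(u)e^{-f_0(u)/\tau}\,du,\qquad F(\mu):=-\tau\log Z(\mu),\qquad\rho_\mu(u):=\frac{\pi_\mu(u)\exp(-f_0(u)/\tau)\mathbf{1}_C(u)}{Z(\mu)}.$$ $\operatorname{Cov}_{\rho}$ is the covariance matrix under the probability density $\rho$. *)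

(* Defs.v *)
From HB Require Import structures.
From mathcomp Require Import all_boot all_order all_algebra.
From mathcomp Require Import all_classical all_reals all_analysis.

Set Implicit Arguments.
Unset Strict Implicit.
Unset Printing Implicit Defensive.
Import Order.TTheory GRing.Theory Num.Theory.
Import numFieldNormedType.Exports.

Local Open Scope classical_set_scope.
Local Open Scope ring_scope.

Fact cV_display : measure_display.
Proof. exact: default_measure_display. Qed.

(* Column vectors carry the sigma-algebra generated by the coordinate maps, as
   the library does for tuples; open_measurable_cV below shows that it contains
   the Borel sets. *)
Section measurable_cV.
Context {R : realType} {m : nat}.

Let coord : 'I_m -> 'cV[R]_m -> measurableTypeR R := fun i u => u i ord0.

Let cV_set0 : g_sigma_preimage coord set0.
Proof. exact: sigma_algebra0. Qed.

Let cV_setC A : g_sigma_preimage coord A -> g_sigma_preimage coord (~` A).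
Proof. exact: sigma_algebraC. Qed.

Let cV_bigcup (F : (set 'cV[R]_m)^nat) :
  (forall i, g_sigma_preimage coord (F i)) ->
  g_sigma_preimage coord (\bigcup_i (F i)).
Proof. exact: sigma_algebra_bigcup. Qed.

HB.instance Definition _ := @isMeasurable.Build cV_display
  'cV[R]_m (g_sigma_preimage coord) cV_set0 cV_setC cV_bigcup.

End measurable_cV.

Section cV_measurability.
Context {R : realType}.

Lemma measurable_cV_coord m (i : 'I_m) :
  measurable_fun [set: 'cV[R]_m] (fun u => u i ord0 : measurableTypeR R).
Proof.
move=> _ Y mY; rewrite setTI; apply: sub_sigma_algebra => /=.
rewrite -bigcup_seq/=; exists i => /=; first by rewrite mem_index_enum.
by exists Y => //; rewrite setTI.
Qed.

Lemma measurable_fun_cV d (T : measurableType d) m (f : T -> 'cV[R]_m) :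
  (forall i, measurable_fun [set: T] (fun x => f x i ord0 : measurableTypeR R)) ->
  measurable_fun [set: T] f.
Proof.
move=> mf _ B; rewrite setTI.
pose G : set (set 'cV[R]_m) := [set B | measurable (f @^-1` B)].
suff : (@measurable _ 'cV[R]_m) `<=` G by apply.
apply: smallest_sub.
  split; rewrite /G /=.
  - by rewrite preimage_set0.
  - by move=> A mA; rewrite setTD preimage_setC; exact: measurableC.
  - by move=> F mF; rewrite preimage_bigcup; exact: bigcupT_measurable.
rewrite -bigcup_seq; apply: bigcup_sub => i _ _ [A mA <-].
by rewrite /G/= setTI -[X in measurable X]setTI; exact: (mf i).
Qed.

End cV_measurability.

(* m-dimensional Lebesgue measure is the m-fold product of one-dimensional
   Lebesgue measure, obtained by transporting lebesgue_measure \x lebesgue_cV m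
   along R x R^m = R^(m+1); lebesgue_cV_box gives its value on boxes. *)
Section lebesgue_cV.
Context {R : realType}.

Definition cV_cons m (xu : measurableTypeR R * 'cV[R]_m) : 'cV[R]_m.+1 :=
  col_mx (xu.1 : R)%:M xu.2.

Definition cV_uncons m (u : 'cV[R]_m.+1) : measurableTypeR R * 'cV[R]_m :=
  (u ord0 ord0, \col_i u (lift ord0 i) ord0).

Lemma cV_consE0 m xu : @cV_cons m xu ord0 ord0 = xu.1.
Proof.
have -> : ord0 = lshift m (ord0 : 'I_1) :> 'I_m.+1 by apply/val_inj.
by rewrite (col_mxEu (xu.1 : R)%:M xu.2) mxE eqxx mulr1n.
Qed.

Lemma cV_consES m xu (i : 'I_m) :
  cV_cons xu (lift ord0 i) ord0 = xu.2 i ord0.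
Proof.
have -> : lift ord0 i = rshift 1 i :> 'I_m.+1 by apply/val_inj.
by rewrite (col_mxEd (xu.1 : R)%:M xu.2).
Qed.

Lemma measurable_cV_cons m :
  measurable_fun [set: measurableTypeR R * 'cV[R]_m] (@cV_cons m).
Proof.
apply: measurable_fun_cV => i.
case: (unliftP ord0 i) => [j|] ->.
  rewrite [X in measurable_fun _ X](_ : _ = (fun u : 'cV[R]_m => u j ord0) \o snd);
    last first.
    by apply/funext => xu /=; rewrite cV_consES.
  by apply: measurableT_comp => //; exact: measurable_cV_coord.
rewrite [X in measurable_fun _ X](_ : _ = fst)//.
by apply/funext => xu /=; rewrite cV_consE0.
Qed.

HB.instance Definition _ m :=
  isMeasurableFun.Build _ _ _ _ (@cV_cons m) (@measurable_cV_cons m).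

Lemma measurable_cV_uncons m : measurable_fun setT (@cV_uncons m).
Proof.
apply/measurable_fun_pairP; split; first exact: measurable_cV_coord.
apply: measurable_fun_cV => i /=.
rewrite [X in measurable_fun _ X](_ : _ =
  (fun u : 'cV[R]_m.+1 => u (lift ord0 i) ord0)).
  by apply: measurable_cV_coord.
by apply/funext => u; rewrite mxE.
Qed.

Lemma cV_consK m : cancel (@cV_cons m) (@cV_uncons m).
Proof.
move=> xu; rewrite /cV_uncons cV_consE0 [RHS]surjective_pairing; congr pair.
by apply/matrixP => i j; rewrite (ord1 j) mxE cV_consES.
Qed.

Lemma cV_unconsK m : cancel (@cV_uncons m) (@cV_cons m).
Proof.
move=> u; apply/matrixP => i j; rewrite (ord1 j).
case: (unliftP ord0 i) => [k|] ->; first by rewrite cV_consES mxE.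
by rewrite cV_consE0.
Qed.

Section step.
Variables (m : nat) (mu : {sigma_finite_measure set 'cV[R]_m -> \bar R}).

Definition lebesgue_step : set 'cV[R]_m.+1 -> \bar R :=
  pushforward (@lebesgue_measure R \x mu)%E (@cV_cons m).

Let lebesgue_step0 : lebesgue_step set0 = 0%E.
Proof. exact: measure0. Qed.

Let lebesgue_step_ge0 A : (0 <= lebesgue_step A)%E.
Proof. exact: measure_ge0. Qed.

Let lebesgue_step_sigma_additive : semi_sigma_additive lebesgue_step.
Proof. exact: measure_semi_sigma_additive. Qed.

HB.instance Definition _ := isMeasure.Build _ _ _ lebesgue_step
  lebesgue_step0 lebesgue_step_ge0 lebesgue_step_sigma_additive.

Let lebesgue_step_sigma_finite : sigma_finite setT lebesgue_step.
Proof.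
have /sigma_finiteP[F [TF ndF Foo]] := sigma_finiteT (@lebesgue_measure R).
have /sigma_finiteP[G [TG ndG Goo]] := sigma_finiteT mu.
exists (fun k => @cV_uncons m @^-1` (F k `*` G k)).
  rewrite -preimage_bigcup (_ : \bigcup_i _ = setT) ?preimage_setT//.
  rewrite predeqE => -[x u]; split=> // _.
  have [i _ Fx] : (\bigcup_i F i) x by rewrite -TF.
  have [j _ Gu] : (\bigcup_i G i) u by rewrite -TG.
  exists (maxn i j) => //; split => /=.
  - by move: x Fx; exact/subsetPset/ndF/leq_maxl.
  - by move: u Gu; exact/subsetPset/ndG/leq_maxr.
move=> k; have [mF Fk] := Foo k; have [mG Gk] := Goo k.
split.
  by rewrite -[X in measurable X]setTI; apply: measurable_cV_uncons => //;
    exact: measurableX.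
rewrite /lebesgue_step /pushforward -comp_preimage.
rewrite (_ : _ \o _ = id); last by apply/funext => x; exact: cV_consK.
by rewrite preimage_id product_measure1E// lte_mul_pinfty// ge0_fin_numE.
Qed.

HB.instance Definition _ := Measure_isSigmaFinite.Build _ _ _ lebesgue_step
  lebesgue_step_sigma_finite.

End step.

Fixpoint lebesgue_cV m : {sigma_finite_measure set 'cV[R]_m -> \bar R} :=
  match m with
  | 0 => dirac (0 : 'cV[R]_0)
  | k.+1 => lebesgue_step (lebesgue_cV k)
  end.

Lemma measurable_cV_box m (A : 'I_m -> set (measurableTypeR R)) :
  (forall i, measurable (A i)) ->
  measurable [set u : 'cV[R]_m | forall i, A i (u i ord0)].
Proof.
move=> mA.
rewrite [X in measurable X](_ : _ =
    \big[setI/setT]_(i < m) [set u : 'cV[R]_m | A i (u i ord0)]).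
  apply: bigsetI_measurable => i _; rewrite -[X in measurable X]setTI.
  exact: (measurable_cV_coord i).
by rewrite -bigcap_seq; apply/seteqP; split=> u /= Au i => [_|];
  apply: Au; rewrite /= mem_index_enum.
Qed.

Lemma lebesgue_cV_box m (A : 'I_m -> set (measurableTypeR R)) :
  (forall i, measurable (A i)) ->
  lebesgue_cV m [set u : 'cV[R]_m | forall i, A i (u i ord0)] =
  (\prod_(i < m) lebesgue_measure (A i))%E.
Proof.
elim: m A => [|m IHm] A mA.
  by rewrite big_ord0 /= diracE mem_set//= => -[].
rewrite big_ord_recl -(IHm (fun i => A (lift ord0 i)))//.
have mB := measurable_cV_box (fun i => mA (lift ord0 i)).
rewrite -(product_measure1E _ _ (mA ord0) mB) /=.
rewrite /lebesgue_step /pushforward; congr (_ _).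
apply/seteqP; split=> [xu /= Axu|xu /= [Ax Au] i].
  split=> [|i]; first by have := Axu ord0; rewrite cV_consE0.
  by have := Axu (lift ord0 i); rewrite cV_consES.
by case: (unliftP ord0 i) => [j|] ->; rewrite ?cV_consES ?cV_consE0.
Qed.

End lebesgue_cV.

Lemma open_measurable_cV (R : realType) m (U : set 'cV[R]_m) :
  open U -> measurable U.
Proof.
pose box (pq : 'cV[rat]_m * 'cV[rat]_m) : set 'cV[R]_m :=
  [set u | forall i, `]ratr (pq.1 i ord0), ratr (pq.2 i ord0)[%classic
                       (u i ord0 : R)].
move=> oU.
rewrite (_ : U = \bigcup_pq (if `[< box pq `<=` U >] then box pq else set0)).
  apply: countable_bigcupT_measurable => // pq; case: ifPn => // _.
  apply: (@measurable_cV_box R m (fun i =>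
    `]ratr (pq.1 i ord0), ratr (pq.2 i ord0)[%classic)) => i.
  exact: measurable_itv.
apply/seteqP; split=> [u Uu|u [pq _]]; last first.
  by case: ifPn => // /asboolP; apply.
have /nbhs_ballP[e /= e0 eU] : nbhs u U by exact: open_nbhs_nbhs.
have /choice[p pP] (i : 'I_m) : exists q, ratr q \in `]u i ord0 - e, u i ord0[.
  by apply: rat_in_itvoo; rewrite ltrBlDr ltrDl.
have /choice[q qP] (i : 'I_m) : exists q, ratr q \in `]u i ord0, u i ord0 + e[.
  by apply: rat_in_itvoo; rewrite ltrDl.
have Bu : box (\col_i p i, \col_i q i) u.
  move=> i /=; rewrite !mxE in_itv/=.
  by move: (pP i) (qP i); rewrite !in_itv/= => /andP[_ ->] /andP[->].
exists (\col_i p i, \col_i q i) => //; case: ifPn => // /asboolP[].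
move=> v /= Bv; apply: eU; split=> // i j; rewrite (ord1 j).
move: (Bv i) (pP i) (qP i); rewrite /= !mxE !in_itv/=.
move=> /andP[pv vq] /andP[up _] /andP[_ qu].
rewrite /ball/= ltr_distlC; apply/andP; split.
- exact: lt_trans pv.
- exact: lt_trans qu.
Qed.

Section second_derivative.
Context {R : realType} {m : nat}.
Implicit Types (f : 'cV[R]_m -> R) (x : 'cV[R]_m).

Definition partial (i : 'I_m) f x : R := 'D_(delta_mx i ord0) f x.

Definition gradient f x : 'cV[R]_m := \col_i partial i f x.

Definition hessian f x : 'M[R]_m := \matrix_(i, j) partial i (partial j f) x.

(* 'D_v is total; this is the Frechet differentiability under which gradient
   and hessian are meaningful. *)
Definition twice_differentiable f x : Prop :=
  (\forall y \near x, differentiable f y) /\ differentiable (gradient f) x.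

End second_derivative.

Section positive_matrices.
Context {R : realType} {m : nat}.
Implicit Types A S : 'M[R]_m.

Definition quadform A (v : 'cV[R]_m) : R := (v^T *m A *m v) ord0 ord0.

Definition sym_posdef A : Prop :=
  A^T = A /\ forall v, v != 0 -> 0 < quadform A v.

Definition sym_possemidef A : Prop :=
  A^T = A /\ forall v, 0 <= quadform A v.

(* The principal square root: the symmetric positive semidefinite S with
   S S = A, which exists and is unique when A is positive semidefinite;
   0 when there is none. *)
Definition sqrtmx A : 'M[R]_m :=
  xget 0 [set S | sym_possemidef S /\ S *m S = A].

End positive_matrices.

Section gibbs.
Context {R : realType} {m : nat}.
Implicit Types (rho : 'cV[R]_m -> R) (mu u : 'cV[R]_m) (Sigma : 'M[R]_m).

Definition gaussian_pdf mu Sigma u : R :=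
  (Num.sqrt ((2 * pi) ^+ m * \det Sigma))^-1 *
  expR (- (2^-1 * quadform (invmx Sigma) (u - mu))).

Definition mean rho : 'cV[R]_m :=
  \col_i \int[lebesgue_cV m]_u (u i ord0 * rho u).

Definition Cov rho : 'M[R]_m :=
  \matrix_(i, j) \int[lebesgue_cV m]_u
    ((u i ord0 - mean rho i ord0) * (u j ord0 - mean rho j ord0) * rho u).

(* prior mu is the density of the prior with parameter mu. *)
Variables (C : set 'cV[R]_m) (f0 : 'cV[R]_m -> R) (tau : R).
Variable prior : 'cV[R]_m -> 'cV[R]_m -> R.

Definition partition_fun mu : R :=
  \int[lebesgue_cV m]_(u in C) (prior mu u * expR (- f0 u / tau)).

Definition free_energy mu : R := - tau * ln (partition_fun mu).

Definition gibbs_density mu u : R :=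
  prior mu u * expR (- f0 u / tau) * \1_C u / partition_fun mu.

End gibbs.

(* Main.v *)
Require Import Defs.
From HB Require Import structures.
From mathcomp Require Import all_boot all_order all_algebra.
From mathcomp Require Import all_classical all_reals all_analysis.
From mathcomp Require Import measurable_realfun complex ring lra.

Set Implicit Arguments.
Unset Strict Implicit.
Unset Printing Implicit Defensive.
Import Order.TTheory GRing.Theory Num.Theory.
Import numFieldNormedType.Exports.
Local Open Scope classical_set_scope.
Local Open Scope ring_scope.

(** The Gaussian exponent, once expanded, makes the mean a natural parameter:
    with K the inverse of Sigma,
      prior mu u * exp (- f0 u / tau) = a(mu) * exp <mu, K u> * g(u),
    where a(mu) is a constant times exp (- <mu, K mu> / 2) and g is a positive
    continuous weight that does not involve mu (gaussian_tilt).  So the Gibbs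
    densities form an exponential family on C with statistic T(u) = K u, and
      F(mu) = const + tau/2 <mu, K mu> - tau ln L(mu)
    with L(mu) the integral over C of exp <mu, T(u)> g(u) (free_energyE).  The
    gradient of ln L is the expectation of T and its Hessian is the covariance
    of T (log_laplace_has_gradient, expect_has_gradient); for T = K u this
    covariance is K Cov(u) K (statistic_covar).

    Differentiation under the integral sign is quantitative: T is bounded on
    the compact set C, and |exp s - 1 - s| <= 2 s^2 for s <= 1/2, so integrating
    the pointwise remainder bounds the remainder of the integral by a multiple
    of |v|^2 (laplace_has_gradient).  The derivative has the same
    form with weight T_k g, so the same lemma differentiates it again.

    The second identity is the first one conjugated by the square root of
    Sigma / tau.  Since sqrtmx selects an arbitrary element of a set, a root must
    be shown to exist (sqrtmx_exists) and to be unique (sqrtmx_unique); the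
    latter identifies sqrtmx (a Sigma) with sqrt a times sqrtmx Sigma. *)

(** * Positive matrices *)

Section quadform.
Context {R : realType} {n : nat}.
Implicit Types (A B S T : 'M[R]_n) (v w : 'cV[R]_n).

Lemma mulmx_tr_ge0 v : 0 <= (v^T *m v) ord0 ord0.
Proof. by rewrite mxE sumr_ge0// => i _; rewrite mxE -expr2 sqr_ge0. Qed.

Lemma mulmx_tr_gt0 v : v != 0 -> 0 < (v^T *m v) ord0 ord0.
Proof.
move=> v0; rewrite lt_neqAle mulmx_tr_ge0 andbT eq_sym.
apply: contra v0 => /eqP; rewrite mxE => /eqP.
rewrite psumr_eq0 => [/allP vi|i _]; last by rewrite mxE -expr2 sqr_ge0.
apply/eqP/matrixP => i j; rewrite (ord1 j) [RHS]mxE.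
have := vi i (mem_index_enum _).
by rewrite /= mxE mulf_eq0 orbb => /eqP.
Qed.

Lemma sym_posdef_unitmx A : sym_posdef A -> A \in unitmx.
Proof.
move=> [_ Apos]; rewrite -row_free_unit -kermx_eq0.
apply/negPn/negP => /rowV0Pn[v /sub_kermxP vA v0].
have := Apos v^T; rewrite trmx_eq0 => /(_ v0).
by rewrite /quadform trmxK vA mul0mx mxE ltxx.
Qed.

(** Cauchy-Schwarz in disguise: [t |-> quadform S (t v + S v)] is affine in t
    with slope twice the squared length of S v, and an affine function that is
    bounded below has slope zero. *)
Lemma possemidef_kernel S v : sym_possemidef S -> quadform S v = 0 -> S *m v = 0.
Proof.
move=> [Ssym Spos] Sv0.
pose b := (S *m v)^T *m (S *m v); pose c := quadform S (S *m v).
have expand t : quadform S (t *: v + S *m v) = t *+ 2 * b ord0 ord0 + c.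
  rewrite /quadform /b /c /quadform !linearD/= !linearZ/=.
  rewrite trmx_mul Ssym !mulmxDl -!scalemxAl !mulmxA.
  have : v^T *m S *m v = 0.
    by apply/matrixP => i j; rewrite !ord1 [RHS]mxE; exact: Sv0.
  move=> ->; rewrite !mxE !(mulr0, add0r). ring.
have : b ord0 ord0 = 0.
  apply/eqP/negPn/negP => b0.
  (* this value of t makes the affine function equal to -1 *)
  have := Spos (((- c - 1) / (b ord0 ord0 *+ 2)) *: v + S *m v).
  rewrite expand (_ : _ * _ + c = -1); first by rewrite ler0N1.
  by field.
move=> b0; apply/eqP/negPn/negP => /mulmx_tr_gt0.
by rewrite -/b b0 ltxx.
Qed.

(** With D = S - T one has S D + D T = S^2 - T^2 = 0, so D S D = - D D T and, by
    cyclicity, the traces of D S D and D T D add up to 0.  Their diagonal entries are the values of the forms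
    S and T on the columns of D, so all of them vanish, each column of D lies in
    the kernel of S, and S is invertible. *)
Lemma sqrtmx_unique A S T : A \in unitmx -> sym_possemidef S ->
  sym_possemidef T -> S *m S = A -> T *m T = A -> S = T.
Proof.
move=> Aunit Spsd Tpsd SA TA; apply/eqP; rewrite -subr_eq0; apply/eqP.
have [Ssym Spos] := Spsd; have [Tsym Tpos] := Tpsd.
have Sunit : S \in unitmx by move: Aunit; rewrite -SA unitmx_mul => /andP[].
set D := S - T.
have Dsym : D^T = D by rewrite /D linearB/= Ssym Tsym.
have SDDT : S *m D + D *m T = 0.
  by rewrite /D mulmxBr mulmxBl SA TA addrC addrA subrK subrr.
have trDSD : \tr (D *m S *m D) + \tr (D *m T *m D) = 0.
  rewrite [\tr (D *m T *m D)]mxtrace_mulC -!mulmxA -mxtraceD -mulmxDr.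
  by rewrite SDDT mulmx0 mxtrace0.
have qf (B : 'M[R]_n) i : quadform B (col i D) = (D *m B *m D) i i.
  rewrite /quadform tr_col Dsym -row_mul !mxE.
  by apply: eq_bigr => k _; rewrite !mxE.
have DS0 i : quadform S (col i D) = 0.
  apply/eqP; rewrite eq_le Spos andbT.
  have : quadform S (col i D) <= \tr (D *m S *m D).
    rewrite qf /mxtrace (bigD1 i)//= lerDl sumr_ge0// => j _.
    by rewrite -qf; exact: Spos.
  move=> /le_trans; apply.
  rewrite -[leRHS]trDSD lerDl sumr_ge0// => j _.
  by rewrite -qf; exact: Tpos.
rewrite -[LHS](mulKmx Sunit); apply/eqP.
rewrite (_ : S *m D = 0) ?mulmx0//.
apply/matrixP => i j.
have /matrixP/(_ i ord0) := possemidef_kernel Spsd (DS0 j).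
rewrite !mxE => Sij; rewrite -[RHS]Sij.
by apply: eq_bigr => k _; rewrite [in RHS]mxE.
Qed.

Lemma sym_posdef_eigenvalue_gt0 A a : sym_posdef A -> eigenvalue A a -> 0 < a.
Proof.
move=> [_ Apos] /eigenvalueP[v vA v0].
have := Apos v^T; rewrite trmx_eq0 => /(_ v0).
rewrite /quadform trmxK vA -scalemxAl mxE pmulr_lgt0//.
by have := @mulmx_tr_gt0 v^T; rewrite trmx_eq0 trmxK; exact.
Qed.

End quadform.

(** * The principal square root *)

Lemma poly_interpolation (K : fieldType) (f : K -> K) (s : seq K) :
  exists p : {poly K}, {in s, forall x, p.[x] = f x}.
Proof.
elim: s => [|a s [p ps]]; first by exists 0.
have [as_|as_] := boolP (a \in s).
  by exists p => x; rewrite inE => /orP[/eqP->|]; exact: ps.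
pose q := \prod_(b <- s) ('X - b%:P) : {poly K}.
have qs x : x \in s -> q.[x] = 0 by move=> xs; apply/rootP; rewrite root_prod_XsubC.
have qa : q.[a] != 0 by rewrite -/(root q a) root_prod_XsubC.
exists (p + ((f a - p.[a]) / q.[a])%:P * q) => x.
rewrite inE hornerD hornerM hornerC => /orP[/eqP->|xs].
  by rewrite divfK// addrC subrK.
by rewrite (qs _ xs) mulr0 addr0 ps.
Qed.

Section sqrtmx_existence.
Context {R : realType}.

(** A is Hermitian over the complex numbers, hence unitarily diagonalizable there;
    the diagonal form of a Hermitian matrix is real, and a real eigenvalue of the
    complexification of A is an eigenvalue of A. *)
Lemma symmetric_diagonalizable n (A : 'M[R]_n) : A^T = A ->
  exists (P : 'M[R[i]]_n) (d : 'rV[R]_n), [/\ P \in unitmx,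
    map_mx (real_complex R) A =
      invmx P *m diag_mx (map_mx (real_complex R) d) *m P &
    forall j, eigenvalue A (d ord0 j)].
Proof.
move=> Asym; pose toC := real_complex R.
pose M := map_mx toC A.
have Mherm : M \is hermsymmx.
  apply: realsym_hermsym.
    apply/is_hermitianmxP; rewrite expr0 scale1r; apply/matrixP => i j.
    by rewrite !mxE -[in LHS]Asym mxE.
  by apply/mxOverP => i j; rewrite mxE complex_real.
have /hermitian_normalmx/orthomx_spectralP Mdiag := Mherm.
have dreal := hermitian_spectral_diag_real Mherm.
set P := spectralmx M in Mdiag; set d := spectral_diag M in Mdiag dreal.
have Punit : P \in unitmx := spectral_unit M.
have dE : d = map_mx toC (map_mx (@complex.Re R) d).
  apply/matrixP => i j; rewrite !mxE; apply/esym/RRe_real.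
  by have /mxOverP := dreal; exact.
exists P, (map_mx (@complex.Re R) d).
split=> [||j]; [exact: Punit | rewrite -dE; exact: Mdiag |].
rewrite -(eigenvalue_map toC) -/M.
apply/eigenvalueP; exists (row j P).
  rewrite -row_mul [in LHS]Mdiag !mulmxA mulmxV// mul1mx row_mul row_diag_mx.
  by rewrite -scalemxAl -rowE {1}dE mxE.
apply/eqP => /(congr1 (mulmx^~ (invmx P))); rewrite mul0mx -row_mul mulmxV//.
by move=> /matrixP/(_ ord0 j)/eqP; rewrite !mxE eqxx oner_eq0.
Qed.

Lemma tr_horner_mx n (A : 'M[R]_n.+1) (p : {poly R}) : A^T = A ->
  (horner_mx A p)^T = horner_mx A p.
Proof.
move=> Asym; elim/poly_ind: p => [|p c IHp]; first by rewrite rmorph0 trmx0.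
rewrite rmorphD rmorphM /= horner_mx_X horner_mx_C linearD/= tr_scalar_mx.
rewrite trmx_mul IHp Asym; congr (_ + _).
exact: comm_mx_horner.
Qed.

(** Let p interpolate the fourth root at the eigenvalues of A.  Then T = p(A) is
    symmetric and T^4 = A by diagonalization, and T^2 is a root that is visibly
    positive semidefinite, its form at v being the squared length of T v.  The
    complex change of basis never appears in the root, which is a real
    polynomial in A. *)
Lemma sqrtmx_exists n (A : 'M[R]_n) : sym_posdef A ->
  exists S, sym_possemidef S /\ S *m S = A.
Proof.
case: n A => [|n] A Apd.
  exists 0; split; last by apply/matrixP => -[].
  split=> [|v]; first by rewrite trmx0.
  by rewrite /quadform mulmx0 mul0mx mxE.
have [Asym _] := Apd.
have [P [d [Punit Adiag dA]]] := symmetric_diagonalizable Asym.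
have [p pE] := poly_interpolation (fun a => Num.sqrt (Num.sqrt a))
  [seq d ord0 j | j : 'I_n.+1].
pose T := horner_mx A p.
have Tsym : T^T = T.
  exact: tr_horner_mx.
have T4 : (T *m T) *m (T *m T) = A.
  apply: (map_mx_inj (f := real_complex R)).
  rewrite -[LHS]/(map_mx _ (T * T * (T * T))) /T -!rmorphM /= map_horner_mx.
  rewrite Adiag horner_mx_uconjC// horner_mx_diag; congr (_ *m diag_mx _ *m _).
  apply/matrixP => i j; rewrite ord1 !mxE horner_map !hornerM pE ?map_f ?mem_enum//.
  have d0 := ltW (sym_posdef_eigenvalue_gt0 Apd (dA j)).
  by rewrite -!expr2 !sqr_sqrtr// sqrtr_ge0.
exists (T *m T); split=> //; split=> [|v]; first by rewrite trmx_mul Tsym.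
rewrite /quadform -{1}Tsym !mulmxA -mulmxA -trmx_mul.
exact: mulmx_tr_ge0.
Qed.
End sqrtmx_existence.

Section principal_square_root.
Context {R : realType} {n : nat}.
Implicit Types A : 'M[R]_n.

Lemma sqrtmxP A : sym_posdef A ->
  sym_possemidef (sqrtmx A) /\ sqrtmx A *m sqrtmx A = A.
Proof. by move=> /sqrtmx_exists/(xgetPex 0). Qed.

Lemma sym_posdefZ a A : 0 < a -> sym_posdef A -> sym_posdef (a *: A).
Proof.
move=> a0 [Asym Apos]; split=> [|v v0]; first by rewrite linearZ/= Asym.
by rewrite /quadform -scalemxAr -scalemxAl mxE mulr_gt0//; exact: Apos.
Qed.

Lemma sqrtmxZ a A : 0 < a -> sym_posdef A ->
  sqrtmx (a *: A) = Num.sqrt a *: sqrtmx A.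
Proof.
move=> a0 Apd; have aApd := sym_posdefZ a0 Apd.
have [[Ssym Spos] SA] := sqrtmxP Apd; have [Tpsd TA] := sqrtmxP aApd.
apply: (sqrtmx_unique (sym_posdef_unitmx aApd) Tpsd _ TA).
  split=> [|v]; first by rewrite linearZ/= Ssym.
  by rewrite /quadform -scalemxAr -scalemxAl mxE mulr_ge0 ?sqrtr_ge0//; exact: Spos.
by rewrite -scalemxAr -scalemxAl SA scalerA -expr2 sqr_sqrtr// ltW.
Qed.

(** The determinant is the square of that of the square root. *)
Lemma sym_posdef_det_gt0 A : sym_posdef A -> 0 < \det A.
Proof.
move=> Apd; have [_ SA] := sqrtmxP Apd.
have := sym_posdef_unitmx Apd; rewrite unitmxE unitfE -{}SA det_mulmx.
by rewrite mulf_eq0 orbb => S0; rewrite -expr2 exprn_even_gt0.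
Qed.

Lemma sym_invmx A : A^T = A -> (invmx A)^T = invmx A.
Proof. by rewrite trmx_inv => ->. Qed.

End principal_square_root.

(** * Scalar products and gradients *)

Section dot.
Context {R : realType} {m : nat}.
Implicit Types (u v w : 'cV[R]_m).

Definition dot u v : R := \sum_k u k ord0 * v k ord0.

Lemma dotC u v : dot u v = dot v u.
Proof. by apply: eq_bigr => k _; rewrite mulrC. Qed.

Lemma dotDl u v w : dot (u + v) w = dot u w + dot v w.
Proof. by rewrite -big_split; apply: eq_bigr => k _; rewrite mxE mulrDl. Qed.

Lemma dotZl a u v : dot (a *: u) v = a * dot u v.
Proof. by rewrite mulr_sumr; apply: eq_bigr => k _; rewrite mxE mulrA. Qed.

Lemma dotDr u v w : dot u (v + w) = dot u v + dot u w.
Proof. by rewrite dotC dotDl ![dot _ u]dotC. Qed.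

Lemma dotZr a u v : dot u (a *: v) = a * dot u v.
Proof. by rewrite dotC dotZl dotC. Qed.

Lemma dot_delta i v : dot (delta_mx i ord0) v = v i ord0.
Proof.
rewrite /dot (bigD1 i)//= mxE !eqxx mul1r big1 ?addr0// => k ki.
by rewrite mxE (negbTE ki) mul0r.
Qed.

Lemma normr_coord_le v (i : 'I_m) : `|v i ord0| <= `|v|.
Proof.
rewrite [leRHS]mx_normrE.
by rewrite (bigD1 (i, ord0))//= le_max lexx.
Qed.

Lemma normr_dot_le u v : `|dot u v| <= m%:R * `|u| * `|v|.
Proof.
rewrite (le_trans (ler_norm_sum _ _ _))//.
have : \sum_(k < m) `|u k ord0 * v k ord0| <= \sum_(k < m) `|u| * `|v|.
  by apply: ler_sum => k _; rewrite normrM ler_pM// normr_coord_le.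
by move=> /le_trans; apply; rewrite sumr_const card_ord -[leLHS]mulr_natl mulrA.
Qed.

End dot.

Lemma continuous_funM (R : realType) (T : topologicalType) (f g : T -> R) :
  continuous f -> continuous g -> continuous (fun x => f x * g x).
Proof. by move=> cf cg x; exact: (@continuousM R T f g x (cf x) (cg x)). Qed.

Lemma continuous_funB (R : realType) (T : topologicalType) (f g : T -> R) :
  continuous f -> continuous g -> continuous (fun x => f x - g x).
Proof. by move=> cf cg x; exact: (@continuousB R R T f g x (cf x) (cg x)). Qed.

Lemma continuous_fun_norm (R : realType) (T : topologicalType) (f : T -> R) :
  continuous f -> continuous (fun x => `|f x|).
Proof.
by move=> cf x; apply: (@continuous_comp T R R f); [exact: cf|exact: norm_continuous].
Qed.

Lemma continuous_fun_expR (R : realType) (T : topologicalType) (f : T -> R) :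
  continuous f -> continuous (fun x => expR (f x)).
Proof.
by move=> cf x; apply: (@continuous_comp T R R f); [exact: cf|exact: continuous_expR].
Qed.

Lemma continuous_bigsum (R : realType) (T : topologicalType) (I : Type)
    (s : seq I) (f : I -> T -> R) :
  (forall i, continuous (f i)) -> continuous (fun x => \sum_(i <- s) f i x).
Proof.
move=> cf x; elim: s => [|i s IHs].
  rewrite (_ : (fun _ => _) = cst 0); first exact: cst_continuous.
  by apply/funext => y; rewrite big_nil.
rewrite (_ : (fun _ => _) = (fun y => f i y + \sum_(j <- s) f j y)).
  by apply: continuousD => //; exact: cf.
by apply/funext => y; rewrite big_cons.
Qed.

Lemma continuous_dot (R : realType) (m : nat) (T : topologicalType)
    (f : T -> 'cV[R]_m) (c : 'cV[R]_m) :
  (forall k, continuous (fun x => f x k ord0)) ->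
  continuous (fun x => dot (f x) c).
Proof.
move=> cf; apply: continuous_bigsum => k x.
by apply: continuousM; [exact: cf|exact: cst_continuous].
Qed.

(** Integrals and quadratic forms are differentiated through this criterion, as
    their remainders have explicit quadratic bounds. *)
Lemma quadratic_error_is_diff (R : realType) (V W : normedModType R)
    (f : V -> W) (df : {linear V -> W}) (x : V) (r M : R) :
  continuous df -> 0 < r ->
  (forall v, `|v| <= r -> `|f (v + x) - f x - df v| <= M * `|v| ^+ 2) ->
  is_diff x f df.
Proof.
move=> dfc r0 fM.
have fo : f \o shift x = cst (f x) + df +o_ 0 id.
  apply/eqaddoP => e e0; near=> v.
  rewrite !fctE /= opprD addrA.
  have vr : `|v| <= r.
    by near: v; apply/nbhs_norm0P; exists r => //= v /ltW.
  have ve : `|v| <= e / (`|M| + 1).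
    near: v; apply/nbhs_norm0P; exists (e / (`|M| + 1)) => /=; last by move=> v /ltW.
    by rewrite divr_gt0// ltr_wpDl.
  apply: (le_trans (fM v vr)).
  rewrite expr2 mulrA ler_wpM2r//.
  apply: (@le_trans _ _ ((`|M| + 1) * `|v|)).
    by rewrite ler_wpM2r// (le_trans (ler_norm M))// lerDl.
  by rewrite -ler_pdivlMl ?ltr_wpDl// mulrC.
have dE : 'd f x = df :> (_ -> _) by exact: diff_unique.
apply: DiffDef; last exact: dE.
by apply/diff_locallyP; split; rewrite dE.
Unshelve. all: by end_near.
Qed.

Section has_gradient.
Context {R : realType} {m : nat}.
Implicit Types (f g : 'cV[R]_m -> R) (x v c d : 'cV[R]_m).

Definition has_gradient f x c := is_diff x f (fun v => dot v c).

Let dot_is_linear c : linear (fun v => dot v c).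
Proof. by move=> a u v; rewrite dotDl dotZl. Qed.

Lemma quadratic_error_has_gradient f x c (r M : R) : 0 < r ->
  (forall v, `|v| <= r -> `|f (v + x) - f x - dot v c| <= M * `|v| ^+ 2) ->
  has_gradient f x c.
Proof.
move=> r0 fM.
pose L : {linear 'cV[R]_m -> R} :=
  HB.pack (fun v => dot v c) (GRing.isLinear.Build _ _ _ _ _ (dot_is_linear c)).
apply: (@quadratic_error_is_diff _ _ _ _ L _ _ _ _ r0 fM).
by apply: continuous_dot => k; exact: coord_continuous.
Qed.

Lemma has_gradient_partial f x c i :
  has_gradient f x c -> partial i f x = c i ord0.
Proof.
rewrite /has_gradient => fx; rewrite /partial deriveE; last exact: ex_diff.
by rewrite diff_val dot_delta.
Qed.

Lemma has_gradient_differentiable f x c :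
  has_gradient f x c -> differentiable f x.
Proof. by rewrite /has_gradient => fx; exact: ex_diff. Qed.

Lemma has_gradient_cst a x : has_gradient (fun=> a) x 0.
Proof.
apply: (@quadratic_error_has_gradient _ _ _ 1 0); first exact: ltr01.
move=> v _; rewrite subrr add0r normrN mul0r.
by rewrite /dot big1 ?normr0// => k _; rewrite mxE mulr0.
Qed.

Lemma has_gradient_dot c x : has_gradient (fun y => dot y c) x c.
Proof.
apply: (@quadratic_error_has_gradient _ _ _ 1 0); first exact: ltr01.
move=> v _.
by rewrite dotDl addrK subrr normr0 mul0r.
Qed.

Lemma has_gradientD f g x c d : has_gradient f x c -> has_gradient g x d ->
  has_gradient (fun y => f y + g y) x (c + d).
Proof.
move=> fx gx; apply: (is_diff_eq (is_diffD fx gx)).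
by apply/funext => v; rewrite dotDr.
Qed.

Lemma has_gradientZ f x c a : has_gradient f x c ->
  has_gradient (fun y => a * f y) x (a *: c).
Proof.
move=> fx; apply: (is_diff_eq (is_diffZ a fx)).
by apply/funext => v; rewrite dotZr.
Qed.

Lemma has_gradientM f g x c d : has_gradient f x c -> has_gradient g x d ->
  has_gradient (fun y => f y * g y) x (f x *: d + g x *: c).
Proof.
move=> fx gx; apply: (is_diff_eq (is_diffM fx gx)).
by apply/funext => v; rewrite dotDr !dotZr.
Qed.

Lemma has_gradient_comp (phi : R -> R) f x c a : is_derive (f x) 1 phi a ->
  has_gradient f x c -> has_gradient (fun y => phi (f y)) x (a *: c).
Proof.
move=> phix fx.
have dphi : differentiable phi (f x) by apply/derivable1_diffP; exact: ex_derive.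
have phid : is_diff (f x) phi (fun y : R => y *: (a : R)).
  apply: DiffDef => //; rewrite diff1E// derive1E.
  by rewrite derive_val.
apply: (is_diff_eq (is_diff_comp fx phid)).
by apply/funext => v /=; rewrite dotZr mulrC.
Qed.

Lemma has_gradientV f x c : f x != 0 -> has_gradient f x c ->
  has_gradient (fun y => (f y)^-1) x (- (f x) ^- 2 *: c).
Proof.
move=> fx0; apply: has_gradient_comp.
have fid : id (f x) != 0 by [].
apply: (is_derive_eq (is_deriveV fid (is_derive_id (f x) 1))).
by rewrite -[LHS]/(_ * _) mulr1.
Qed.

Lemma differentiable_col (F : 'cV[R]_m -> 'cV[R]_m) x :
  (forall i, differentiable (fun y => F y i ord0) x) -> differentiable F x.
Proof.
move=> dF.
rewrite (_ : F = \sum_(i < m) (fun y => F y i ord0 *: delta_mx i ord0)).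
  by apply: differentiable_sum => i; exact: differentiableZl.
apply/funext => y; rewrite fct_sumE; apply/matrixP => i j.
rewrite (ord1 j) summxE (bigD1 i)//= big1 ?addr0; first by rewrite !mxE !eqxx mulr1.
by move=> k ki; rewrite !mxE eq_sym (negbTE ki) mulr0.
Qed.

End has_gradient.

Section quadratic_form.
Context {R : realType} {m : nat}.
Implicit Types (K : 'M[R]_m) (u v x : 'cV[R]_m).

Lemma quadformE K v : quadform K v = dot v (K *m v).
Proof. by rewrite /quadform -mulmxA mxE; apply: eq_bigr => k _; rewrite mxE. Qed.

Lemma dot_mulmx K u v : dot u (K *m v) = dot (K^T *m u) v.
Proof.
have dE (x y : 'cV[R]_m) : dot x y = (x^T *m y) ord0 ord0.
  by rewrite mxE; apply: eq_bigr => k _; rewrite mxE.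
by rewrite !dE trmx_mul trmxK mulmxA.
Qed.

Lemma quadformD K u v : K^T = K ->
  quadform K (u + v) = quadform K u + 2 * dot u (K *m v) + quadform K v.
Proof.
move=> Ksym; rewrite !quadformE mulmxDr !dotDl !dotDr.
have -> : dot v (K *m u) = dot u (K *m v) by rewrite dot_mulmx Ksym dotC.
by ring.
Qed.

Lemma quadformN K u : quadform K (- u) = quadform K u.
Proof. by rewrite !quadformE -scaleN1r -scalemxAr dotZl dotZr; ring. Qed.

Lemma normr_quadform_le K v :
  `|quadform K v| <= (\sum_i \sum_j `|K i j|) * `|v| ^+ 2.
Proof.
rewrite quadformE (le_trans (ler_norm_sum _ _ _))// mulr_suml ler_sum// => i _.
rewrite normrM mxE (le_trans (ler_wpM2l _ (ler_norm_sum _ _ _)))//.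
rewrite mulr_sumr mulr_suml ler_sum// => j _; rewrite normrM mulrCA ler_wpM2l//.
by rewrite expr2 ler_pM// normr_coord_le.
Qed.

(** The remainder of a quadratic form is the form itself at the increment. *)
Lemma quadform_has_gradient K x : K^T = K ->
  has_gradient (quadform K) x (2 *: (K *m x)).
Proof.
move=> Ksym; apply: (@quadratic_error_has_gradient _ _ _ _ _ 1); first exact: ltr01.
move=> v _; rewrite quadformD// dotZr.
rewrite (_ : _ - _ - _ = quadform K v); last by ring.
exact: normr_quadform_le.
Qed.

Lemma continuous_mulmx_coord K k : continuous (fun u => (K *m u) k ord0).
Proof.
rewrite (_ : (fun _ => _) = (fun u => dot u (\col_j K k j))).
  by apply: continuous_dot => j; exact: coord_continuous.
apply/funext => u; rewrite mxE dotC; apply: eq_bigr => j _.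
by rewrite mxE.
Qed.

Lemma continuous_quadform K : continuous (quadform K).
Proof.
rewrite (_ : quadform K = (fun u => \sum_k u k ord0 * (K *m u) k ord0)).
  apply: continuous_bigsum => k; apply: continuous_funM; first exact: coord_continuous.
  exact: continuous_mulmx_coord.
by apply/funext => u; rewrite quadformE.
Qed.

End quadratic_form.

(** * Integrals of continuous functions over a compact set *)

Section compact_integrals.
Context {R : realType} {m : nat}.
Implicit Types (C : set 'cV[R]_m) (f g : 'cV[R]_m -> R).

Lemma continuous_measurable_cV f : continuous f ->
  measurable_fun [set: 'cV[R]_m] (f : 'cV[R]_m -> measurableTypeR R).
Proof.
move=> /continuousP cf; apply: (measurability _ (RGenOpens.measurableE R)).
move=> _ [_ [a [b ->] <-]]; rewrite setTI; apply: open_measurable_cV.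
exact/cf/interval_open.
Qed.

Lemma compact_measurable_cV C : compact C -> measurable C.
Proof.
move=> /(compact_closed (@norm_hausdorff _ _)) /closed_openC /open_measurable_cV.
by move=> /measurableC; rewrite setCK.
Qed.

Lemma compact_lebesgue_cV_lty C : compact C -> (lebesgue_cV m C < +oo)%E.
Proof.
move=> cC; have [M [_ CM]] := compact_bounded cC.
have {}CM : forall u, C u -> `|u| <= M + 1.
  by move=> u; apply: CM; rewrite ltrDl.
pose I : set (measurableTypeR R) := `[- (M + 1), M + 1]%classic.
apply: (@le_lt_trans _ _ (lebesgue_cV m [set u : 'cV[R]_m | forall i, I (u i ord0)])).
  apply: le_measure; rewrite ?inE.
  - exact: compact_measurable_cV.
  - by apply: (@measurable_cV_box R m (fun=> I)) => i; exact: measurable_itv.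
  - move=> u Cu i; rewrite /I /= in_itv /= -ler_norml.
    by rewrite (le_trans (normr_coord_le _ _))// CM.
rewrite (@lebesgue_cV_box R m (fun=> I)); last by move=> i; exact: measurable_itv.
suff : (\prod_(i < m) lebesgue_measure I)%E \is a fin_num.
  by move=> /fin_numPlt/andP[].
apply: (big_ind (fun x => x \is a fin_num)) => // [x y|i _]; first exact: fin_numM.
by rewrite lebesgue_measure_itv /=; case: ifP.
Qed.

Lemma compact_continuous_bounded C f : compact C -> continuous f ->
  exists2 M, 0 < M & forall u, C u -> `|f u| <= M.
Proof.
move=> cC cf.
have /compact_bounded[M [_ fM]] : compact (f @` C).
  by apply: continuous_compact => //; exact: continuous_subspaceT.
exists (`|M| + 1) => [|u Cu]; first by rewrite ltr_wpDl.
apply: fM; last by exists u.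
by rewrite (le_lt_trans (ler_norm M))// ltrDl.
Qed.

Lemma compact_continuous_integrable C f : compact C -> continuous f ->
  (lebesgue_cV m).-integrable C (EFin \o f).
Proof.
move=> cC cf; have [M M0 fM] := compact_continuous_bounded cC cf.
apply: measurable_bounded_integrable.
- exact: compact_measurable_cV.
- exact: compact_lebesgue_cV_lty.
- exact: measurable_funS (continuous_measurable_cV cf).
- exists M; split; first exact: num_real.
  by move=> x Mx u Cu /=; rewrite (le_trans (fM u Cu))// ltW.
Qed.

(** A bound M of 1 / f on C gives the constant lower bound 1 / M of f. *)
Lemma compact_Rintegral_gt0 C f : compact C -> (0 < lebesgue_cV m C)%E ->
  continuous f -> (forall u, 0 < f u) -> 0 < \int[lebesgue_cV m]_(u in C) f u.
Proof.
move=> cC C0 cf f0.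
have cfV : continuous (fun u => (f u)^-1).
  by move=> u; apply: continuousV; [rewrite gt_eqF|exact: cf].
have [M M0 fM] := compact_continuous_bounded cC cfV.
have mC := compact_measurable_cV cC.
apply: (@lt_le_trans _ _ (\int[lebesgue_cV m]_(u in C) M^-1)).
  rewrite Rintegral_cst// mulr_gt0 ?invr_gt0// fine_gt0// C0/=.
  exact: compact_lebesgue_cV_lty.
apply: le_Rintegral => //.
- by apply: compact_continuous_integrable => // u; exact: cst_continuous.
- exact: compact_continuous_integrable.
move=> u Cu; rewrite -[leRHS]invrK lef_pV2 ?posrE ?invr_gt0//.
by rewrite (le_trans (ler_norm _))// fM.
Qed.

End compact_integrals.

(** * Exponential families *)

(** Below by [1 + s <= exp s]; above by the same inequality at -s, which gives
    [exp s <= 1 / (1 - s)], and [1 / (1 - s) - 1 - s = s^2 / (1 - s)]. *)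
Lemma expR_second_order_le (R : realType) (s : R) : s <= 2^-1 ->
  `|expR s - 1 - s| <= 2 * s ^+ 2.
Proof.
move=> s2; rewrite ger0_norm; last by rewrite -addrA -opprD subr_ge0 expR_ge1Dx.
have s1 : 0 < 1 - s by lra.
have : expR s <= (1 - s)^-1.
  rewrite -[leLHS]invrK lef_pV2 ?posrE ?invr_gt0 ?expR_gt0//.
  by rewrite -expRN expR_ge1Dx.
move=> es; rewrite -addrA -opprD lerBlDr (le_trans es)//.
rewrite -[(1 - s)^-1]mul1r ler_pdivrMr//.
nra.
Qed.

(** The family of densities proportional to [exp <x, T u> g(u)] on C: T is the
    sufficient statistic, x the natural parameter and g the base weight. *)
Section exponential_family.
Context {R : realType} {m : nat}.
Variables (C : set 'cV[R]_m) (T : 'cV[R]_m -> 'cV[R]_m) (g : 'cV[R]_m -> R).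
Hypotheses (C_compact : compact C) (C_pos : (0 < lebesgue_cV m C)%E).
Hypothesis T_continuous : forall k, continuous (fun u => T u k ord0).
Hypotheses (g_continuous : continuous g) (g_gt0 : forall u, 0 < g u).
Implicit Types (h : 'cV[R]_m -> R) (x v : 'cV[R]_m).

(** The weight h is arbitrary rather than g so that the derivatives of a Laplace
    transform are again Laplace transforms. *)
Definition laplace h x : R :=
  \int[lebesgue_cV m]_(u in C) (expR (dot x (T u)) * h u).

Let dot_continuous x : continuous (fun u => dot x (T u)).
Proof.
rewrite (_ : (fun _ => _) = (fun u => dot (T u) x)); first exact: continuous_dot.
by apply/funext => u; rewrite dotC.
Qed.

Let tilt_continuous x : continuous (fun u => expR (dot x (T u))).
Proof.
exact: continuous_fun_expR.
Qed.

Let tilted_continuous h x : continuous h ->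
  continuous (fun u => expR (dot x (T u)) * h u).
Proof.
by move=> ch; apply: continuous_funM => //; exact: tilt_continuous.
Qed.

Lemma tilted_integrable h x : continuous h ->
  (lebesgue_cV m).-integrable C (EFin \o (fun u => expR (dot x (T u)) * h u)).
Proof.
by move=> ch; apply: compact_continuous_integrable => //; exact: tilted_continuous.
Qed.

Let mC : measurable C := compact_measurable_cV C_compact.

Lemma laplaceD h1 h2 x : continuous h1 -> continuous h2 ->
  laplace (fun u => h1 u + h2 u) x = laplace h1 x + laplace h2 x.
Proof.
move=> c1 c2; rewrite /laplace -RintegralD//; [|exact: tilted_integrable..].
by apply: eq_Rintegral => u _; rewrite mulrDr.
Qed.

Lemma laplaceZ a h x : continuous h ->
  laplace (fun u => a * h u) x = a * laplace h x.
Proof.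
move=> ch; rewrite /laplace -RintegralZl//; last exact: tilted_integrable.
by apply: eq_Rintegral => u _; rewrite mulrCA.
Qed.

Lemma laplace_sum (I : Type) (s : seq I) (h : I -> 'cV[R]_m -> R) x :
  (forall i, continuous (h i)) ->
  laplace (fun u => \sum_(i <- s) h i u) x = \sum_(i <- s) laplace (h i) x.
Proof.
move=> ch; elim: s => [|i s IHs].
  rewrite big_nil /laplace (@eq_Rintegral _ _ _ _ _ (cst 0)); last first.
    by move=> u _; rewrite big_nil mulr0.
  by rewrite Rintegral_cst// mul0r.
rewrite big_cons -IHs -laplaceD//; last exact: continuous_bigsum.
by apply: eq_Rintegral => u _; rewrite big_cons.
Qed.

Lemma laplace_gt0 x : 0 < laplace g x.
Proof.
apply: compact_Rintegral_gt0 => //; first exact: tilted_continuous.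
by move=> u; rewrite mulr_gt0// expR_gt0.
Qed.

Lemma statistic_bounded : exists2 B, 0 < B & forall u, C u -> `|T u| <= B.
Proof.
have /choice[B BT] k : exists B, forall u, C u -> `|T u k ord0| <= B.
  have [B _ BT] := compact_continuous_bounded C_compact (@T_continuous k).
  by exists B.
exists (\sum_k `|B k| + 1) => [|u Cu].
  by rewrite ltr_wpDl// sumr_ge0.
rewrite [leLHS]mx_normrE; apply: bigmax_le => [|[i j] _ /=].
  by rewrite addr_ge0// sumr_ge0.
rewrite (ord1 j) (le_trans (BT i u Cu))// (le_trans (ler_norm _))//.
by rewrite (bigD1 i)//= -addrA lerDl addr_ge0// sumr_ge0.
Qed.

(** The remainder at v is the integral of [exp <x, T u> * h u] times
    [exp s - 1 - s] with s = <v, T u>.  On C one has |s| <= N |v|, where N is m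
    times a bound of T, so for |v| small the last factor is at most 2 N^2 |v|^2. *)
Lemma laplace_has_gradient h x : continuous h ->
  has_gradient (laplace h) x (\col_k laplace (fun u => T u k ord0 * h u) x).
Proof.
move=> ch; have [B B0 BT] := statistic_bounded.
pose N := m%:R * B.
have N0 : 0 <= N by rewrite mulr_ge0// ltW.
have N1 : 0 < 2 * N + 1 by lra.
have dotN v u : C u -> `|dot v (T u)| <= N * `|v|.
  move=> Cu; rewrite (le_trans (normr_dot_le _ _))// /N.
  by rewrite -!mulrA ler_wpM2l// mulrC ler_wpM2r// BT.
pose M := \int[lebesgue_cV m]_(u in C) (expR (dot x (T u)) * `|h u|).
(* the radius ensures N |v| <= 1/2 *)
apply: (@quadratic_error_has_gradient _ _ _ _ _ ((2 * N + 1)^-1) (2 * N ^+ 2 * M)).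
  by rewrite invr_gt0.
move=> v vN.
pose e u := expR (dot v (T u)) - 1 - dot v (T u).
have ce : continuous e.
  apply: continuous_funB; last exact: dot_continuous.
  apply: continuous_funB; first exact: tilt_continuous.
  by move=> u; exact: cst_continuous.
have cabsh : continuous (fun u => `|h u|).
  exact: continuous_fun_norm.
have eN u : C u -> `|e u| <= 2 * N ^+ 2 * `|v| ^+ 2.
  move=> Cu; apply: (@le_trans _ _ (2 * dot v (T u) ^+ 2)).
    apply: expR_second_order_le.
    rewrite (le_trans (ler_norm _))// (le_trans (dotN _ _ Cu))//.
    rewrite (le_trans (ler_wpM2l N0 vN))// ler_pdivrMr//.
    lra.
  rewrite (_ : 2 * N ^+ 2 * `|v| ^+ 2 = 2 * (N * `|v|) ^+ 2); last by ring.
  rewrite ler_wpM2l// -(real_normK (num_real (dot v (T u)))).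
  have Nv : 0 <= N * `|v| by rewrite mulr_ge0.
  by rewrite ler_sqr ?nnegrE//; exact: dotN.
have -> : laplace h (v + x) - laplace h x -
    dot v (\col_k laplace (fun u => T u k ord0 * h u) x) =
    laplace (fun u => e u * h u) x.
  have c1 : continuous (fun u => expR (dot v (T u)) * h u).
    exact: tilted_continuous.
  have c2 k : continuous (fun u => v k ord0 * (T u k ord0 * h u)).
    apply: continuous_funM; first by move=> u; exact: cst_continuous.
    exact: continuous_funM.
  have c3 : continuous (fun u => -1 * h u).
    by apply: continuous_funM => // u; exact: cst_continuous.
  have c4 : continuous (fun u => \sum_k v k ord0 * (T u k ord0 * h u)).
    exact: continuous_bigsum.
  have -> : laplace h (v + x) = laplace (fun u => expR (dot v (T u)) * h u) x.
    by apply: eq_Rintegral => u _; rewrite dotDl expRD mulrAC mulrC mulrA.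
  have -> : dot v (\col_k laplace (fun u => T u k ord0 * h u) x) =
      laplace (fun u => \sum_k v k ord0 * (T u k ord0 * h u)) x.
    rewrite laplace_sum//; apply: eq_bigr => k _; rewrite mxE laplaceZ//.
    exact: continuous_funM.
  rewrite -[in X in _ - X - _](mul1r (laplace h x)) -mulNr -laplaceZ//.
  rewrite -laplaceD//.
  rewrite -[in X in _ - X](mul1r (laplace _ x)) -mulNr -laplaceZ//.
  rewrite -laplaceD//; last 2 first.
  - rewrite (_ : (fun _ => _) =
      (fun u => expR (dot v (T u)) * h u - 1 * h u)); last first.
      by apply/funext => u; rewrite mulNr.
    apply: continuous_funB => //.
    by apply: continuous_funM => // u; exact: cst_continuous.
  - by apply: continuous_funM => // u; exact: cst_continuous.
  apply: eq_Rintegral => u _; congr (_ * _).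
  rewrite /e !mulrBl !mulNr !mul1r; congr (_ - _).
  by rewrite /dot mulr_suml; apply: eq_bigr => k _; rewrite mulrA.
rewrite (le_trans (le_normr_Rintegral _ _))//.
  by apply: tilted_integrable; exact: continuous_funM.
rewrite mulrAC /M.
rewrite -RintegralZl//; last exact: tilted_integrable.
apply: le_Rintegral => //.
- apply: compact_continuous_integrable => //; apply: continuous_fun_norm.
  by apply: tilted_continuous; exact: continuous_funM.
- apply: compact_continuous_integrable => //.
  apply: continuous_funM; first by move=> u; exact: cst_continuous.
  exact: tilted_continuous.
move=> u Cu; rewrite !normrM ger0_norm ?expR_ge0// mulrCA.
by rewrite ler_wpM2r ?eN// mulr_ge0// expR_ge0.
Qed.

Definition expect h x : R := laplace (fun u => h u * g u) x / laplace g x.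

Let laplace_neq0 x : laplace g x != 0.
Proof. by rewrite gt_eqF// laplace_gt0. Qed.

Lemma expectD h1 h2 x : continuous h1 -> continuous h2 ->
  expect (fun u => h1 u + h2 u) x = expect h1 x + expect h2 x.
Proof.
move=> c1 c2; rewrite /expect -mulrDl -laplaceD; [|exact: continuous_funM..].
by congr (laplace _ _ / _); apply/funext => u; rewrite mulrDl.
Qed.

Lemma expectZ a h x : continuous h ->
  expect (fun u => a * h u) x = a * expect h x.
Proof.
move=> ch; rewrite /expect mulrA -laplaceZ; last exact: continuous_funM.
by congr (laplace _ _ / _); apply/funext => u; rewrite mulrA.
Qed.

Lemma expect_cst a x : expect (fun=> a) x = a.
Proof. by rewrite /expect laplaceZ// mulfK. Qed.

Lemma expect_sum (I : Type) (s : seq I) (h : I -> 'cV[R]_m -> R) x :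
  (forall i, continuous (h i)) ->
  expect (fun u => \sum_(i <- s) h i u) x = \sum_(i <- s) expect (h i) x.
Proof.
move=> ch; rewrite /expect -mulr_suml -laplace_sum; last first.
  by move=> i; exact: continuous_funM.
by congr (laplace _ _ / _); apply/funext => u; rewrite mulr_suml.
Qed.

Definition covar h1 h2 x : R :=
  expect (fun u => (h1 u - expect h1 x) * (h2 u - expect h2 x)) x.

Lemma covarE h1 h2 x : continuous h1 -> continuous h2 ->
  covar h1 h2 x = expect (fun u => h1 u * h2 u) x - expect h1 x * expect h2 x.
Proof.
move=> c1 c2; rewrite /covar.
set a := expect h1 x; set b := expect h2 x.
have cc (r : R) : continuous (fun _ : 'cV[R]_m => r) by move=> u; exact: cst_continuous.
have cr (r : R) h : continuous h -> continuous (fun u => r * h u).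
  by move=> ch; exact: continuous_funM.
rewrite (_ : (fun _ => _) =
    (fun u => h1 u * h2 u + (- b * h1 u + (- a * h2 u + a * b)))); last first.
  by apply/funext => u; ring.
have cD h h' : continuous h -> continuous h' -> continuous (fun u => h u + h' u).
  by move=> ch ch' u; exact: (@continuousD R R _ h h' u (ch u) (ch' u)).
have c12 : continuous (fun u => h1 u * h2 u) by exact: continuous_funM.
have c3 : continuous (fun u => - a * h2 u + a * b) by apply: cD; [exact: cr|exact: cc].
have c4 : continuous (fun u => - b * h1 u + (- a * h2 u + a * b)).
  by apply: cD => //; exact: cr.
rewrite (expectD x c12 c4) (expectD x (cr (- b) h1 c1) c3).
rewrite (expectD x (cr (- a) h2 c2) (cc _)) (expectZ _ x c1) (expectZ _ x c2).
by rewrite expect_cst -/a -/b; ring.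
Qed.

Lemma log_laplace_has_gradient x :
  has_gradient (fun y => ln (laplace g y)) x (\col_k expect (fun u => T u k ord0) x).
Proof.
have := has_gradient_comp (is_derive1_ln (laplace_gt0 x))
  (laplace_has_gradient x g_continuous).
congr (has_gradient _ _ _); apply/matrixP => k j.
by rewrite !mxE /expect mulrC.
Qed.

(** Quotient rule for L(h g) / L(g): the gradient has coordinates
    E[T_k h] - E[T_k] E[h]. *)
Lemma expect_has_gradient h x : continuous h ->
  has_gradient (expect h) x (\col_k covar (fun u => T u k ord0) h x).
Proof.
move=> ch; have chg : continuous (fun u => h u * g u) by exact: continuous_funM.
have := has_gradientM (laplace_has_gradient x chg)
  (has_gradientV (laplace_neq0 x) (laplace_has_gradient x g_continuous)).
congr (has_gradient _ _ _); apply/matrixP => k j.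
rewrite !mxE covarE// /expect.
rewrite (_ : (fun u => T u k ord0 * h u * g u) = (fun u => T u k ord0 * (h u * g u))).
  by have Lx := laplace_neq0 x; field.
by apply/funext => u; rewrite mulrA.
Qed.

End exponential_family.

(** * The free energy of a Gaussian prior *)

Section gaussian_prior.
Context {R : realType} {m : nat}.
Variables (C : set 'cV[R]_m) (f0 : 'cV[R]_m -> R) (tau : R) (Sigma : 'M[R]_m).
Hypotheses (C_compact : compact C) (C_pos : (0 < lebesgue_cV m C)%E).
Hypotheses (f0_continuous : continuous f0) (tau_gt0 : 0 < tau).
Hypothesis Sigma_spd : sym_posdef Sigma.

Implicit Types (h : 'cV[R]_m -> R) (mu u : 'cV[R]_m).

Let prior mu u : R := gaussian_pdf mu Sigma u.
Let K := invmx Sigma.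
Let T (u : 'cV[R]_m) := K *m u.

(** What is left of the unnormalized Gibbs density when the normalizing constant
    and the terms in mu are taken out of the Gaussian prior. *)
Definition gibbs_weight u : R :=
  expR (- (2^-1 * quadform K u)) * expR (- f0 u / tau).

Let normalization : R := (Num.sqrt ((2 * pi) ^+ m * \det Sigma))^-1.
Let factor mu : R := normalization * expR (- (2^-1 * quadform K mu)).
Let E h mu : R := expect C T gibbs_weight h mu.

Let Ksym : K^T = K.
Proof. by apply: sym_invmx; case: Sigma_spd. Qed.

Let KC i j : K i j = K j i.
Proof. by rewrite -{1}Ksym mxE. Qed.

Let normalization_gt0 : 0 < normalization.
Proof.
rewrite invr_gt0 sqrtr_gt0 mulr_gt0 ?sym_posdef_det_gt0//.
by rewrite exprn_gt0// mulr_gt0// pi_gt0.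
Qed.

Let T_continuous k : continuous (fun u => T u k ord0).
Proof. exact: continuous_mulmx_coord. Qed.

Let coord_cont k : continuous (fun u : 'cV[R]_m => u k ord0).
Proof. exact: coord_continuous. Qed.

Let gibbs_weight_gt0 u : 0 < gibbs_weight u.
Proof. by rewrite mulr_gt0 ?expR_gt0. Qed.

Let gibbs_weight_continuous : continuous gibbs_weight.
Proof.
apply: continuous_funM; apply: continuous_fun_expR.
  rewrite (_ : (fun _ => _) = (fun u => - 2^-1 * quadform K u)).
    apply: continuous_funM; first by move=> u; exact: cst_continuous.
    exact: continuous_quadform.
  by apply/funext => u; rewrite mulNr.
rewrite (_ : (fun _ => _) = (fun u => - tau^-1 * f0 u)).
  by apply: continuous_funM => // u; exact: cst_continuous.
by apply/funext => u; rewrite mulrC mulrN mulNr.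
Qed.

(** [|u - mu|^2 = |mu|^2 - 2 <mu, K u> + |u|^2] for the norm defined by K: the
    Gaussian prior with mean mu is the exponential tilt by <mu, K u> of a fixed
    weight. *)
Lemma gaussian_tilt mu u :
  prior mu u * expR (- f0 u / tau) =
  factor mu * (expR (dot mu (T u)) * gibbs_weight u).
Proof.
rewrite /prior /gaussian_pdf -/normalization /factor /gibbs_weight -/K.
rewrite addrC quadformD// quadformN.
rewrite (_ : - _ = - (2^-1 * quadform K mu) +
   (dot mu (T u) + - (2^-1 * quadform K u))).
  by rewrite !expRD; ring.
rewrite (_ : dot (- mu) _ = - dot mu (T u)); first by field.
by rewrite -scaleN1r dotZl mulN1r.
Qed.

Lemma partition_funE mu :
  partition_fun C f0 tau prior mu = factor mu * laplace C T gibbs_weight mu.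
Proof.
rewrite /partition_fun (_ : (fun _ => _) =
   (fun u => factor mu * (expR (dot mu (T u)) * gibbs_weight u))).
  rewrite RintegralZl//; first exact: compact_measurable_cV.
  exact: tilted_integrable.
by apply/funext => u; rewrite gaussian_tilt.
Qed.

Let factor_gt0 mu : 0 < factor mu.
Proof. by rewrite mulr_gt0// expR_gt0. Qed.

Let laplace_weight_gt0 mu : 0 < laplace C T gibbs_weight mu.
Proof. exact: laplace_gt0. Qed.

(** The factor a(mu) cancels between the Gibbs density and its partition function,
    which leaves the density of the exponential family. *)
Lemma gibbs_expect h mu : continuous h ->
  \int[lebesgue_cV m]_u (h u * gibbs_density C f0 tau prior mu u) = E h mu.
Proof.
move=> ch; have L0 := laplace_weight_gt0 mu; have a0 := factor_gt0 mu.
have {}L0 : laplace C T gibbs_weight mu != 0 by rewrite gt_eqF.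
have {}a0 : factor mu != 0 by rewrite gt_eqF.
transitivity (\int[lebesgue_cV m]_(u in C) ((laplace C T gibbs_weight mu)^-1 *
    (expR (dot mu (T u)) * (h u * gibbs_weight u)))).
  rewrite [RHS]Rintegral_mkcond; apply: eq_Rintegral => u _.
  rewrite patchE /gibbs_density partition_funE gaussian_tilt indicE.
  case: (u \in C); last by rewrite mulr0 mul0r mulr0.
  by rewrite mulr1; field; rewrite a0 L0.
have cht : continuous (fun u => h u * gibbs_weight u) by exact: continuous_funM.
rewrite (RintegralZl _ (compact_measurable_cV C_compact)
  (tilted_integrable C_compact T_continuous mu cht)).
by rewrite mulrC.
Qed.

Lemma gibbs_mean mu k :
  mean (gibbs_density C f0 tau prior mu) k ord0 = E (fun u => u k ord0) mu.
Proof. by rewrite mxE gibbs_expect. Qed.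

Lemma gibbs_Cov mu i j :
  Cov (gibbs_density C f0 tau prior mu) i j =
  covar C T gibbs_weight (fun u => u i ord0) (fun u => u j ord0) mu.
Proof.
rewrite mxE !gibbs_mean gibbs_expect//.
by apply: continuous_funM; apply: continuous_funB => // u; exact: cst_continuous.
Qed.

(** Bilinearity of the covariance, with T u = K u. *)
Lemma statistic_covar mu i j :
  covar C T gibbs_weight (fun u => T u i ord0) (fun u => T u j ord0) mu =
  (K *m Cov (gibbs_density C f0 tau prior mu) *m K) i j.
Proof.
have Tmean k u : T u k ord0 - E (fun u => T u k ord0) mu =
    \sum_l K k l * (u l ord0 - E (fun u => u l ord0) mu).
  have cl l : continuous (fun u : 'cV[R]_m => K k l * u l ord0).
    by apply: continuous_funM => // v; exact: cst_continuous.
  rewrite (_ : (fun u => T u k ord0) = (fun u => \sum_l K k l * u l ord0)); last first.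
    by apply/funext => v; rewrite mxE.
  rewrite /E expect_sum// mxE -sumrB; apply: eq_bigr => l _.
  by rewrite expectZ// mulrBr.
rewrite /covar.
have cu l : continuous (fun u : 'cV[R]_m => u l ord0 - E (fun u => u l ord0) mu).
  by apply: continuous_funB => // u; exact: cst_continuous.
transitivity (E (fun u => \sum_k \sum_l K i k * K l j *
    ((u k ord0 - E (fun u => u k ord0) mu) *
     (u l ord0 - E (fun u => u l ord0) mu))) mu).
  congr (expect _ _ _ _ _); apply/funext => u; rewrite !Tmean mulr_suml.
  apply: eq_bigr => k _; rewrite mulr_sumr; apply: eq_bigr => l _.
  by rewrite [K j l]KC; ring.
have cc k l : continuous (fun u : 'cV[R]_m =>
    (u k ord0 - E (fun u => u k ord0) mu) * (u l ord0 - E (fun u => u l ord0) mu)).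
  exact: continuous_funM.
have ccK k l : continuous (fun u : 'cV[R]_m => K i k * K l j *
    ((u k ord0 - E (fun u => u k ord0) mu) * (u l ord0 - E (fun u => u l ord0) mu))).
  by apply: continuous_funM => // u; exact: cst_continuous.
rewrite /E expect_sum//; last by move=> k; exact: continuous_bigsum.
rewrite -mulmxA mxE; apply: eq_bigr => k _.
rewrite expect_sum// mxE mulr_sumr; apply: eq_bigr => l _.
by rewrite expectZ// gibbs_Cov mulrA mulrAC -mulrA mulrA.
Qed.

Let F := free_energy C f0 tau prior.

Lemma free_energyE mu : F mu = - tau * ln normalization +
  (tau / 2 * quadform K mu + - tau * ln (laplace C T gibbs_weight mu)).
Proof.
rewrite /F /free_energy partition_funE lnM ?posrE// lnM ?posrE ?expR_gt0// expRK.
by field.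
Qed.

Lemma free_energy_has_gradient mu :
  has_gradient F mu (tau *: (K *m mu) + - tau *: \col_k E (fun u => T u k ord0) mu).
Proof.
rewrite (_ : F = (fun mu => - tau * ln normalization +
  (tau / 2 * quadform K mu + - tau * ln (laplace C T gibbs_weight mu)))); last first.
  by apply/funext => x; exact: free_energyE.
rewrite -[X in has_gradient _ _ X]add0r; apply: has_gradientD.
  exact: has_gradient_cst.
apply: has_gradientD; last first.
  by apply: has_gradientZ; exact: log_laplace_has_gradient.
rewrite (_ : tau *: _ = (tau / 2) *: (2 *: (K *m mu))); last first.
  by rewrite scalerA divfK.
by apply: has_gradientZ; exact: quadform_has_gradient.
Qed.

Lemma partial_free_energy_has_gradient j mu :
  has_gradient (partial j F) mu
    (tau *: col j K + - tau *:
       \col_i covar C T gibbs_weight (fun u => T u i ord0) (fun u => T u j ord0) mu).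
Proof.
rewrite (_ : partial j F =
    (fun x => tau * dot x (col j K) + - tau * E (fun u => T u j ord0) x)); last first.
  apply/funext => x; rewrite (has_gradient_partial _ (free_energy_has_gradient x)).
  rewrite !mxE; congr (_ * _ + _); apply: eq_bigr => k _.
  by rewrite mxE mulrC KC.
by apply: has_gradientD; apply: has_gradientZ;
  [exact: has_gradient_dot|exact: expect_has_gradient].
Qed.

Lemma free_energy_twice_differentiable mu : twice_differentiable F mu.
Proof.
split.
  have dF x : differentiable F x.
    exact: has_gradient_differentiable (free_energy_has_gradient x).
  by near=> x; exact: dF.
apply: differentiable_col => j.
rewrite (_ : (fun _ => _) = partial j F); last by apply/funext => x; rewrite mxE.
exact: has_gradient_differentiable (partial_free_energy_has_gradient j mu).
Unshelve. all: by end_near.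
Qed.

Lemma hessian_free_energy mu :
  hessian F mu = tau *: K -
    tau *: (K *m Cov (gibbs_density C f0 tau prior mu) *m K).
Proof.
apply/matrixP => i j; rewrite mxE.
rewrite (has_gradient_partial _ (partial_free_energy_has_gradient j mu)) !mxE.
by rewrite statistic_covar mulNr !mxE.
Qed.

End gaussian_prior.

Theorem mainTheorem6 (R : realType) (m : nat)
    (C : set 'cV[R]_m) (f0 : 'cV[R]_m -> R) (tau : R) (Sigma : 'M[R]_m)
    (C_nonempty : C !=set0) (C_compact : compact C)
    (C_pos : (0 < lebesgue_cV m C)%E)
    (f0_continuous : continuous f0) (tau_gt0 : 0 < tau)
    (Sigma_spd : sym_posdef Sigma) :
  let prior := fun mu u : 'cV[R]_m => gaussian_pdf mu Sigma u in
  let F := free_energy C f0 tau prior in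
  let rho := gibbs_density C f0 tau prior in
  let P := tau^-1 *: Sigma in
  forall mu : 'cV[R]_m,
    [/\ twice_differentiable F mu,
        hessian F mu = tau *: invmx Sigma -
          tau *: (invmx Sigma *m Cov (rho mu) *m invmx Sigma) &
        sqrtmx P *m hessian F mu *m sqrtmx P =
          1%:M - invmx (sqrtmx Sigma) *m Cov (rho mu) *m invmx (sqrtmx Sigma)].
Proof.
move=> prior F rho P mu.
have hessF : hessian F mu = tau *: invmx Sigma -
    tau *: (invmx Sigma *m Cov (rho mu) *m invmx Sigma).
  exact: hessian_free_energy.
split; [exact: free_energy_twice_differentiable|exact: hessF|].
have tau_neq0 : tau != 0 by rewrite gt_eqF.
have [_ SS] := sqrtmxP Sigma_spd.
have Sunit : sqrtmx Sigma \in unitmx.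
  by have := sym_posdef_unitmx Sigma_spd; rewrite -{1}SS unitmx_mul => /andP[].
rewrite hessF /P sqrtmxZ ?invr_gt0//.
have KE : invmx Sigma = invmx (sqrtmx Sigma) *m invmx (sqrtmx Sigma).
  rewrite -[RHS](mulmxK (sym_posdef_unitmx Sigma_spd)) -[X in _ = _ *m X *m _]SS.
  by rewrite mulmxA mulmxKV// mulVmx// mul1mx.
(* the scalars cancel since sqrtmx P is tau^(-1/2) S; then S K S = 1 and
   S K = K S = S^-1 *)
set S := sqrtmx Sigma in Sunit KE *; rewrite KE.
rewrite -scalemxAr -!scalemxAl scalerA -expr2 sqr_sqrtr ?invr_ge0 ?ltW//.
rewrite -scalerBr -scalemxAr -scalemxAl scalerA mulVf// scale1r.
rewrite mulmxBr mulmxBl !mulmxA mulmxV// mul1mx mulVmx//.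
by rewrite -!mulmxA mulVmx// mulmx1 !mulmxA.
Qed.
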